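(* Fix $\kappa\ge 0$. For $\alpha\in(0,\alpha_c(\kappa))$ let $(q_\alpha,r_\alpha)\in[0,1)\times[0,\infty)$ be the unique solution of the system $q=P(r)$, $r=R_\kappa(q,\alpha)$. Then, as $\alpha\uparrow\alpha_c(\kappa)$, $$q_\alpha\to 1\quad\text{and}\quad r_\alpha\to\infty.$$
   Context: Let $Z\sim\mathcal N(0,1)$ be a standard normal random variable, $\phi(u)=\frac{1}{\sqrt{2\pi}}e^{-u^2/2}$, $\Phi(u)=\int_{-\infty}^u\phi(s)\,ds$, $\overline{\Phi}(u)=1-\Phi(u)$, and $(x)_+=\max\{x,0\}$. Define $E(u)=\phi(u)/\overline{\Phi}(u)$ for $u\in\mathbb R$ (the inverse Mills ratio; $\mathbb E$ denotes expectation). For $q\in[0,1)$ and $x\in\mathbb R$ set $$F_q(x)=\frac{1}{\sqrt{1-q}}\,E\!\left(\frac{\kappa-x}{\sqrt{1-q}}\right).$$ For $r\ge 0$ set $P(r)=\mathbb E[\tanh^2(\sqrt r\,Z)]$. For $\alpha>0$, $\kappa\ge0$, $q\in[0,1)$ set $R_\kappa(q,\alpha)=\alpha\,\mathbb E[F_q(\sqrt q\,Z)^2]$. Set $C_\kappa=\mathbb E[(\kappa-Z)_+^2]=(\kappa^2+1)\Phi(\kappa)+\kappa\phi(\kappa)$ and $\alpha_c(\kappa)=\frac{2}{\pi C_\kappa}$. For every $\kappa\ge0$ and $\alpha\in(0,\alpha_c(\kappa))$ the system $q=P(r)$, $r=R_\kappa(q,\alpha)$ has exactly one solution $(q,r)\in[0,1)\times[0,\infty)$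 (and it has no solution for $\alpha\ge\alpha_c(\kappa)$), so $(q_\alpha,r_\alpha)$ is well defined. *)

(* Defs.v *)
From HB Require Import structures.
From mathcomp Require Import all_boot all_order all_algebra.
From mathcomp Require Import all_classical all_reals all_analysis.

Set Implicit Arguments.
Unset Strict Implicit.
Unset Printing Implicit Defensive.

Import Order.TTheory GRing.Theory Num.Theory.
Import numFieldNormedType.Exports.

Local Open Scope classical_set_scope.
Local Open Scope ring_scope.

(* E[f(Z)] for Z ~ N(0,1), i.e. the expectation of f under the law of Z.  Every
   f used below is nonnegative, continuous and of at most quadratic growth, so
   the extended-real expectation is finite and [fine] loses nothing. *)
Definition gaussE {R : realType} (f : R -> R) : R :=
  fine ('E_(normal_prob (0 : R) 1)[f])%E.

Definition phi {R : realType} (u : R) : R := normal_pdf 0 1 u.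

Definition Phi {R : realType} (u : R) : R :=
  \int[lebesgue_measure]_(s in `]-oo, u]) phi s.

Definition Phibar {R : realType} (u : R) : R := 1 - Phi u.

Definition invMills {R : realType} (u : R) : R := phi u / Phibar u.

Definition tanh {R : realType} (x : R) : R :=
  (expR x - expR (- x)) / (expR x + expR (- x)).

Definition Fq {R : realType} (kappa q x : R) : R :=
  (Num.sqrt (1 - q))^-1 * invMills ((kappa - x) / Num.sqrt (1 - q)).

Definition P_map {R : realType} (r : R) : R :=
  gaussE (fun z => tanh (Num.sqrt r * z) ^+ 2).

Definition R_map {R : realType} (kappa q alpha : R) : R :=
  alpha * gaussE (fun z => Fq kappa q (Num.sqrt q * z) ^+ 2).

Definition Ckappa {R : realType} (kappa : R) : R :=
  gaussE (fun z => Num.max (kappa - z) 0 ^+ 2).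

Definition alpha_c {R : realType} (kappa : R) : R := 2 / (pi * Ckappa kappa).

Definition is_solution {R : realType} (kappa alpha q r : R) : Prop :=
  [/\ 0 <= q < 1, 0 <= r, q = P_map r & r = R_map kappa q alpha].

(* Main.v *)
Require Import Defs.
From HB Require Import structures.
From mathcomp Require Import all_boot all_order all_algebra.
From mathcomp Require Import all_classical all_reals all_analysis.
From mathcomp Require Import measurable_realfun ring lra.
Import Order.TTheory GRing.Theory Num.Theory.
Import numFieldNormedType.Exports.
Local Open Scope classical_set_scope.
Local Open Scope ring_scope.

Set Implicit Arguments.
Unset Strict Implicit.

(** Let M be the inverse Mills ratio and tau = sqrt (2 / pi) = 2 phi(0), so that
alpha_c = tau^2 / C where C = E[(kappa - Z)_+^2].  Each of the two equations
bounds the quantity r (1 - q)^2, and the two bounds meet at alpha = alpha_c.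

The equation q = P(r) gives an upper bound.  The function
sqrt r (1 - tanh^2 (sqrt r z)) is the derivative of tanh (sqrt r z), whose total
increment is 2; integrating it against phi <= phi(0) gives
sqrt r (1 - P(r)) <= 2 phi(0) = tau.  Beyond |z| = 1, where phi <= phi(1), a
proportion 1 - tanh (sqrt r) of this increment remains, so [P_map_gap] improves
the bound by a gap that stays away from 0 as long as r is bounded.

The equation r = R_kappa(q, alpha) gives the lower bound
alpha C <= r (1 - q)^2 ([R_map_ge]), which amounts to
(1 - q)^2 E[F_q(sqrt q Z)^2] >= C for every q in [0, 1).  Put s = sqrt (1 - q)
and X = kappa - sqrt q Z.  The left-hand side is E[s^2 M(X/s)^2].  By rotation
invariance of a standard Gaussian pair (Z, W), the right-hand side is
E[(X - s W)_+^2] = E[s^2 c(X/s)], where c(u) = E[(u - W)_+^2].  The pointwise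
inequality M(u)^2 >= c(u) is false for very negative u, but it is true for
u >= 0 ([gauss_pos_sqr_le_invMills]), and after pairing u with -u it is true
everywhere: M(u)^2 + M(-u)^2 >= u^2 + 1 = c(u) + c(-u) ([invMills_sqrN]).
Because kappa >= 0, the law of X gives more weight to u >= 0 than to -u, and
folding the line at 0 turns these two facts into the inequality of expectations
([gauss_int_le_fold]).

Hence alpha C <= r (1 - q)^2 <= (tau - gap(r))^2.  When alpha tends to
alpha_c = tau^2 / C, the gap is forced to vanish, so r tends to infinity; and
then 1 - q <= tau / sqrt r tends to 0. *)
Section fixed_point.
Context {R : realType}.
Implicit Types u x : R.

Local Notation mu := (@lebesgue_measure R).
Local Notation phi := (@phi R).
Local Notation Phi := (@Phi R).
Local Notation tanh := (@tanh R).

(** * Calculus on the real line *)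

Lemma is_derive_continuous (f : R -> R) (x df : R) :
  is_derive x 1 f df -> {for x, continuous f}.
Proof.
move=> fdf; apply: differentiable_continuous; apply/derivable1_diffP.
exact: ex_derive.
Qed.

Lemma mean_value (f df : R -> R) a b : a <= b ->
  (forall x, a <= x <= b -> is_derive x 1 f (df x)) ->
  exists2 c, a <= c <= b & f b - f a = df c * (b - a).
Proof.
move=> ab fdf; have [| |c cI e] := @MVT_segment R f df a b ab.
- by move=> x; rewrite in_itv/= => /andP[ax xb]; apply: fdf; rewrite !ltW.
- apply: derivable_within_continuous => x; rewrite in_itv/= => xI.
  by have := fdf x xI => dx; exact: ex_derive.
- by exists c => //; move: cI; rewrite in_itv.
Qed.

Lemma ndecr_is_derive (f df : R -> R) a b : a <= b ->
  (forall x, a <= x <= b -> is_derive x 1 f (df x)) ->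
  (forall x, a <= x <= b -> 0 <= df x) -> f a <= f b.
Proof.
move=> ab fdf df0; have [c cI e] := mean_value ab fdf.
by rewrite -subr_ge0 e mulr_ge0 ?df0// subr_ge0.
Qed.

Lemma nincr_is_derive (f df : R -> R) a b : a <= b ->
  (forall x, a <= x <= b -> is_derive x 1 f (df x)) ->
  (forall x, a <= x <= b -> df x <= 0) -> f b <= f a.
Proof.
move=> ab fdf df0; have [c cI e] := mean_value ab fdf.
by rewrite -subr_le0 e mulr_le0_ge0 ?df0// subr_ge0.
Qed.

Lemma continuous_sqr_pos (k : R) : continuous (fun w => Num.max (k - w) 0 ^+ 2).
Proof.
move=> w; apply: (@continuous_comp _ _ _ (fun w => Num.max (k - w) 0)
  (fun x => x ^+ 2)); last exact: exprn_continuous.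
apply: continuous_max; last exact: cvg_cst.
by apply: cvgB; [exact: cvg_cst|exact: cvg_id].
Qed.

(** * The standard normal density and distribution function *)

Lemma phiE x : phi x = phi 0 * expR (- (x ^+ 2 / 2)).
Proof.
rewrite /phi normal_pdfE ?oner_eq0// /normal_fun !subr0 expr1n.
by rewrite expr0n/= oppr0 mul0r expR0 mulr1 mulNr.
Qed.

Lemma phi0E : phi (0 : R) = (Num.sqrt (2 * pi))^-1.
Proof.
rewrite /phi normal_pdfE ?oner_eq0// /normal_fun subr0 expr0n/= oppr0 mul0r.
by rewrite expR0 mulr1 /normal_peak expr1n mul1r -mulr_natl.
Qed.

Lemma phi_gt0 x : 0 < phi x.
Proof.
by rewrite phiE mulr_gt0 ?expR_gt0// phi0E invr_gt0 sqrtr_gt0 mulr_gt0// pi_gt0.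
Qed.

Lemma phi_ge0 x : 0 <= phi x.
Proof. exact/ltW/phi_gt0. Qed.

Lemma sqr_phi0 : phi (0 : R) ^+ 2 = (2 * pi)^-1.
Proof. by rewrite phi0E exprVn sqr_sqrtr// mulr_ge0// pi_ge0. Qed.

Lemma phiN x : phi (- x) = phi x.
Proof. by rewrite phiE sqrrN -phiE. Qed.

Lemma phi_le x y : `|x| <= `|y| -> phi y <= phi x.
Proof.
move=> xy; rewrite [leLHS]phiE [leRHS]phiE ler_pM2l ?phi_gt0// ler_expR lerN2.
by rewrite ler_pM2r ?invr_gt0// -[x ^+ 2]real_normK ?num_real//
  -[y ^+ 2]real_normK ?num_real// lerXn2r ?nnegrE.
Qed.

Lemma is_derive_phi x : is_derive x 1 phi (- x * phi x).
Proof.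
rewrite (_ : phi = fun y => phi 0 * expR (- (y ^+ 2 / 2))); last first.
  by apply/funext => y; exact: phiE.
apply: is_derive_eq.
by rewrite /GRing.scale/=; field.
Qed.

#[local] Existing Instance is_derive_phi.

Lemma continuous_phi : continuous phi.
Proof. by apply: continuous_normal_pdf; rewrite oner_eq0. Qed.

Lemma measurable_phi : measurable_fun setT phi.
Proof. exact: measurable_normal_pdf. Qed.

Lemma integrable_phi (A : set R) : measurable A ->
  mu.-integrable A (EFin \o phi).
Proof.
move=> mA; apply: (integrableS (E := setT)) => //.
exact: (integrable_normal_pdf 0 1).
Qed.

Lemma PhiE u : (Phi u)%:E = normal_prob 0 1 `]-oo, u].
Proof.
rewrite /Phi /Rintegral /normal_prob fineK//.
by apply: integrable_fin_num => //; exact: integrable_phi.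
Qed.

Lemma is_derive_Phi u : is_derive u 1 Phi (phi u).
Proof.
have uu : u < u + 1 by rewrite ltrDl.
have [] := @continuous_FTC1 R phi -oo%O u (u + 1) uu
  (integrable_phi (measurable_itv _)) (ltNyr u) (@continuous_phi u).
rewrite derive1E => dF eF.
by rewrite -eF; exact: DeriveDef.
Qed.

#[local] Existing Instance is_derive_Phi.

Lemma continuous_Phi : continuous Phi.
Proof.
by move=> u; exact: is_derive_continuous (is_derive_Phi u).
Qed.

Lemma Phi_le1 u : Phi u <= 1.
Proof. by rewrite -lee_fin PhiE probability_le1. Qed.

Lemma cvg_Phi_pinfty : Phi u @[u --> +oo] --> (1 : R).
Proof.
pose P : probability _ R := normal_prob 0 1.
pose idR : measurableTypeR R -> R := idfun.
pose X : {RV P >-> R} :=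
  HB.pack idR (@isMeasurableFun.Build _ _ _ _ idR (@measurable_id _ _ setT)).
have H := @cvg_cdfy1 _ _ R P X.
have : (fun u => (Phi u)%:E) @ +oo --> 1%E.
  by under eq_fun do rewrite PhiE; exact: H.
by move=> /fine_cvg.
Qed.

Lemma Phi_lt u v : u < v -> Phi u < Phi v.
Proof.
move=> uv; have [x _] := @MVT R Phi phi u v uv (fun x _ => is_derive_Phi x)
  (continuous_subspaceT continuous_Phi).
move/eqP; rewrite subr_eq => /eqP ->.
by rewrite ltrDr mulr_gt0 ?phi_gt0 ?subr_gt0.
Qed.

Lemma Phibar_gt0 u : 0 < Phibar u.
Proof.
rewrite subr_gt0 (lt_le_trans _ (Phi_le1 (u + 1)))//.
by rewrite Phi_lt// ltrDl.
Qed.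

Lemma Phi0 : Phi 0 = 1 / 2.
Proof.
have e : (\int[mu]_(x in `]-oo, 0%R]) (phi x)%:E =
    \int[mu]_(x in `[0%R, +oo[) (phi x)%:E)%E.
  have := @ge0_integration_by_substitutionNy R phi 0.
  rewrite oppr0 => ->.
  - by apply: eq_integral => x _ /=; rewrite phiN.
  - exact/continuous_subspaceT/continuous_phi.
  - by move=> x _; exact/ltW/phi_gt0.
have s := integral_normal_pdf (0 : R) 1.
rewrite ge0_symfun_integralT in s.
- rewrite -set_itvcy -e in s.
  have f : (\int[mu]_(x in `]-oo, 0%R]) (phi x)%:E)%E \is a fin_num.
    by apply: integrable_fin_num => //; exact: integrable_phi.
  move: s; rewrite -(fineK f) -EFinM => -[] s.
  by rewrite /Phi /Rintegral; lra.
- by move=> x; exact/ltW/phi_gt0.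
- exact: continuous_phi.
- by move=> x; exact/esym/phiN.
Qed.

Lemma PhiN u : Phi (- u) = 1 - Phi u.
Proof.
pose g := fun u : R => Phi u + Phi (- u).
have dg x : is_derive x 1 g 0.
  by apply: is_derive_eq; rewrite phiN /GRing.scale/= mulrN1 subrr.
have gE x : g x = g 0.
  have [x0|/ltW x0] := leP 0 x.
  + have [c _] := mean_value x0 (fun y _ => dg y).
    by rewrite mul0r => /eqP; rewrite subr_eq0 => /eqP.
  + have [c _] := mean_value x0 (fun y _ => dg y).
    by rewrite mul0r => /eqP; rewrite subr_eq0 => /eqP.
by have := gE u; rewrite /g oppr0 !Phi0; lra.
Qed.

(** * Lower bounds for the inverse Mills ratio *)

Lemma Phi_gt0 u : 0 < Phi u.
Proof. by have := Phibar_gt0 (- u); rewrite /Phibar PhiN opprB addrC subrK. Qed.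

Lemma invMills_gt0 u : 0 < invMills u.
Proof. by rewrite divr_gt0 ?phi_gt0 ?Phibar_gt0. Qed.

Lemma le_invMills (t u : R) : 0 < t ->
  (t <= invMills u) = (0 <= phi u / t - Phibar u).
Proof.
move=> t0; rewrite /invMills ler_pdivlMr ?Phibar_gt0// subr_ge0.
by rewrite ler_pdivlMr// mulrC.
Qed.

(** A lower bound T for the ratio is proved by following the difference of
phi / T and the Gaussian tail: its derivative has the sign of
T^2 - x T - T', in which the Gaussian integral no longer occurs. *)
Lemma is_derive_mills_gap (T : R -> R) (x dT : R) : T x != 0 ->
  is_derive x 1 T dT ->
  is_derive x 1 (fun y => phi y / T y - Phibar y)
    (phi x / T x ^+ 2 * (T x ^+ 2 - x * T x - dT)).
Proof.
move=> Tn0 TdT; have dV := @is_deriveV _ T x _ 1 Tn0 TdT.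
have := is_deriveB (is_deriveM (is_derive_phi x) dV)
  (is_deriveB (is_derive_cst (1 : R) x 1) (is_derive_Phi x)).
by move=> /is_derive_eq; apply; rewrite /GRing.scale/=; field.
Qed.

(** The difference phi / T - Phibar with T = sqrt (1 + x^2) decreases to 0 at
infinity, hence is nonnegative.  Its derivative has the right sign as soon as
x^4 + x^2 >= 1, which 4/5 satisfies. *)
Lemma invMills_ge_sqrt u : 4 / 5 <= u -> Num.sqrt (1 + u ^+ 2) <= invMills u.
Proof.
move=> u45; pose T x : R := Num.sqrt (1 + x ^+ 2).
have T2 x : T x ^+ 2 = 1 + x ^+ 2 by rewrite sqr_sqrtr// addr_ge0// sqr_ge0.
have T0 x : 0 < T x by rewrite sqrtr_gt0 ltr_pwDl// sqr_ge0.
pose g x := phi x / T x - Phibar x.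
have dg x :
    is_derive x 1 g (phi x / T x ^+ 3 * (T x ^+ 3 - x * (T x ^+ 2 + 1))).
  have x1 : 0 < 1 + x ^+ 2 by rewrite ltr_pwDl// sqr_ge0.
  have dT : is_derive x 1 T (x / T x).
    have d1 := is_derive1_sqrt x1; rewrite -/(T x) in d1.
    have d2 : is_derive x 1 (fun y : R => 1 + y ^+ 2) (2 * x).
      by apply: is_derive_eq; rewrite /GRing.scale/=; ring.
    have := @is_derive1_comp _ Num.sqrt (fun y : R => 1 + y ^+ 2) x _ _ d1 d2.
    move=> /is_derive_eq; apply; rewrite /GRing.scale/=; field.
    by rewrite gt_eqF.
  have Tn0 : T x != 0 by rewrite gt_eqF.
  have := is_derive_mills_gap Tn0 dT.
  by move=> /is_derive_eq; apply; field.
have g_le v : u <= v -> g v <= g u.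
  move=> uv; apply: nincr_is_derive uv (fun x _ => dg x) _.
  move=> x /andP[ux _]; rewrite mulr_ge0_le0//.
    by rewrite divr_ge0 ?exprn_ge0// ltW// phi_gt0.
  have x45 : 4 / 5 <= x by exact: le_trans ux.
  have T3 : T x ^+ 3 \is Num.nneg by rewrite nnegrE exprn_ge0// ltW.
  have xT : x * (T x ^+ 2 + 1) \is Num.nneg.
    by rewrite nnegrE T2 mulr_ge0 ?addr_ge0 ?sqr_ge0//; lra.
  rewrite subr_le0 -(@ler_pXn2r _ 2)// -exprM mulnC exprM !T2 -subr_ge0.
  rewrite (_ : _ - _ = x ^+ 4 + x ^+ 2 - 1); last by ring.
  have x2 : 16 / 25 <= x ^+ 2 by nra.
  by rewrite (exprM x 2 2); nra.
rewrite (le_invMills _ (T0 u)) -/(g u).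
have cv : Phi v - 1 @[v --> +oo] --> (0 : R).
  rewrite -[X in _ --> X](subrr (1 : R)).
  by apply: cvgB; [exact: cvg_Phi_pinfty|exact: cvg_cst].
apply: (cvgr_to_le cv); near=> v.
have uv : u <= v by near: v; apply: nbhs_pinfty_ge; exact: num_real.
apply: le_trans (g_le v uv).
by rewrite /g /Phibar opprB lerDr divr_ge0// ltW// phi_gt0.
Unshelve. all: end_near. Qed.

(** The constant sqrt (2 / pi), which is also E|Z|. *)
Definition tau : R := 2 * phi 0.

Lemma tau2E : tau ^+ 2 = 2 / pi.
Proof.
rewrite exprMn sqr_phi0 invfM; have := lt0r_neq0 (@pi_gt0 R).
by move: pi => p p0; field.
Qed.

(** Machin's observation: four times the angle atan (1/5) has tangent 120/119,
so it exceeds pi / 4, while atan (1/5) <= 1/5. *)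
Lemma pi_le : pi <= 16 / 5 :> R.
Proof.
pose t : R := atan (5^-1).
have t0 : 0 < t by rewrite -(@atan0 R) lt_atan.
have t1 : t <= 5^-1.
  have r0 : (0 : R) <= 5^-1 by [].
  have [x xI] := mean_value r0 (fun x _ => is_derive1_atan x).
  rewrite atan0 !subr0 -/t => ->.
  by rewrite ler_piMl// invf_le1 ?ltr_pwDl// ?sqr_ge0// lerDl sqr_ge0.
have t2 : t *+ 2 *+ 2 < pi / 2 by have := @pi_ge2 R; lra.
have cp x : 0 < x -> x < pi / 2 -> cos x != 0.
  by move=> x0 x1; rewrite gt_eqF// cos_gt0_pihalf// x1 andbT; lra.
have tt : tan t = 5^-1 by rewrite /t atanK.
have tt2 : tan (t *+ 2) = 5 / 12.
  by rewrite tan_mulr2n ?cp//; [rewrite tt; field|lra].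
have tt4 : tan (t *+ 2 *+ 2) = 120 / 119.
  by rewrite tan_mulr2n ?cp//; [rewrite tt2; field|lra|lra].
have : pi / 4 < t *+ 2 *+ 2.
  rewrite -ltr_tan ?in_itv/=.
  - by rewrite tan_piquarter tt4; lra.
  - have := @pi_gt0 R; lra.
  - rewrite t2 andbT. have := @pi_gt0 R; lra.
lra.
Qed.

Lemma tau2_ge : 5 / 8 <= tau ^+ 2.
Proof.
by rewrite tau2E ler_pdivlMr ?pi_gt0//; have := pi_le; lra.
Qed.

Lemma tau_le1 : tau <= 1.
Proof.
rewrite -(@ler_pXn2r _ 2) ?nnegrE//; last by rewrite mulr_ge0// ltW// phi_gt0.
by rewrite expr1n tau2E ler_pdivrMr ?pi_gt0// mul1r pi_ge2.
Qed.

Lemma tau_ge : 79 / 100 <= tau.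
Proof.
rewrite -(@ler_pXn2r _ 2) ?nnegrE//; last by rewrite mulr_ge0// ltW// phi_gt0.
by apply: le_trans tau2_ge; lra.
Qed.

(** The tangent line at 0 of the convex function [invMills]: the value there is tau and
the slope tau^2.  With L the line, phi / L - Phibar vanishes at 0, and its
derivative is x times a factor that is nonnegative on [-4/5, 4/5], thanks to
pi <= 16/5. *)
Lemma invMills_ge_tangent u : - (4 / 5) <= u <= 4 / 5 ->
  tau + tau ^+ 2 * u <= invMills u.
Proof.
move=> uI; have t2 := tau2_ge; have t1 := tau_le1; have t0 := tau_ge.
pose L x := tau + tau ^+ 2 * x.
have L0 x : - (4 / 5) <= x <= 4 / 5 -> 0 < L x by rewrite /L => xI; nra.
pose g x := phi x / L x - Phibar x.
pose k x := tau * (2 * tau ^+ 2 - 1 - tau * (1 - tau ^+ 2) * x).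
have k0 x : - (4 / 5) <= x <= 4 / 5 -> 0 <= k x.
  move=> xI; apply: mulr_ge0; first lra.
  have : tau * (1 - tau ^+ 2) * x <= tau * (1 - tau ^+ 2) * (4 / 5).
    by apply: ler_wpM2l; [apply: mulr_ge0; nra|lra].
  have : tau * (1 - tau ^+ 2) <= tau * (3 / 8) by apply: ler_wpM2l; lra.
  nra.
have dg x : - (4 / 5) <= x <= 4 / 5 ->
    is_derive x 1 g (phi x / L x ^+ 2 * k x * x).
  move=> xI; have Ln0 : L x != 0 by rewrite gt_eqF// L0.
  have dL : is_derive x 1 L (tau ^+ 2).
    by apply: is_derive_eq; rewrite /GRing.scale/=; ring.
  have := is_derive_mills_gap Ln0 dL.
  move=> /is_derive_eq; apply; rewrite -[RHS]mulrA; congr (_ * _).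
  by rewrite /L /k; ring.
have pk x : - (4 / 5) <= x <= 4 / 5 -> 0 <= phi x / L x ^+ 2 * k x.
  move=> xI; rewrite mulr_ge0 ?k0// divr_ge0 ?exprn_ge0// ltW ?L0//.
  exact: phi_gt0.
have g0 : g 0 = 0.
  rewrite /g /L mulr0 addr0 /Phibar Phi0 /tau; field.
  by rewrite gt_eqF// phi_gt0.
rewrite le_invMills ?L0// -/(g u) -g0.
have [u0|/ltW u0] := leP 0 u.
- apply: (ndecr_is_derive u0) (fun x xI => dg x _) _ => x; first by lra.
  by move=> xI; apply: mulr_ge0; [apply: pk|]; lra.
- apply: (nincr_is_derive u0) (fun x xI => dg x _) _ => x; first by lra.
  by move=> xI; apply: mulr_ge0_le0; [apply: pk|]; lra.
Qed.

Lemma invMills_sqr_ge u : 4 / 5 <= u -> u ^+ 2 + 1 <= invMills u ^+ 2.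
Proof.
move=> u45; rewrite addrC -[leLHS]sqr_sqrtr ?addr_ge0 ?sqr_ge0//.
by rewrite lerXn2r ?nnegrE ?sqrtr_ge0 ?(ltW (invMills_gt0 u)) ?invMills_ge_sqrt.
Qed.

Lemma invMills_sqr_ge_tangent u : - (4 / 5) <= u <= 4 / 5 ->
  (tau + tau ^+ 2 * u) ^+ 2 <= invMills u ^+ 2.
Proof.
move=> uI; have t1 := tau_le1; have t0 := tau_ge.
have L0 : 0 <= tau + tau ^+ 2 * u by nra.
by rewrite lerXn2r ?nnegrE ?(ltW (invMills_gt0 u)) ?invMills_ge_tangent.
Qed.

(** Near 0 the two tangent lines give 2 tau^2 + 2 tau^4 u^2, whose constant term
4 / pi leaves enough room; for larger u the square at u alone suffices. *)
Lemma invMills_sqrN u : 0 <= u ->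
  u ^+ 2 + 1 <= invMills u ^+ 2 + invMills (- u) ^+ 2.
Proof.
move=> u0; have [u45|/ltW u45] := leP u (4 / 5); last first.
  by rewrite ler_wpDr ?sqr_ge0// invMills_sqr_ge.
have t2 := tau2_ge.
have h1 : (tau + tau ^+ 2 * u) ^+ 2 <= invMills u ^+ 2.
  by apply: invMills_sqr_ge_tangent; lra.
have h2 : (tau + tau ^+ 2 * (- u)) ^+ 2 <= invMills (- u) ^+ 2.
  by apply: invMills_sqr_ge_tangent; lra.
apply: le_trans (lerD h1 h2).
have : (5 / 8) ^+ 2 * u ^+ 2 <= (tau ^+ 2) ^+ 2 * u ^+ 2.
  by apply: ler_wpM2r; rewrite ?sqr_ge0// lerXn2r ?nnegrE//; lra.
nra.
Qed.

(** * Integration against the standard normal law *)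

(** The expectation of f(Z) before [fine], as a Lebesgue integral with a density:
the form in which changes of variables and Tonelli's theorem apply. *)
Definition gauss_int (f : R -> R) : \bar R := (\int[mu]_x (f x * phi x)%:E)%E.

Lemma gauss_int_normal_prob (f : R -> R) : measurable_fun setT f ->
  (forall x, 0 <= f x) ->
  (\int[normal_prob (0 : R) 1]_x (f x)%:E = gauss_int f)%E.
Proof.
move=> mf f0; pose P : probability _ R := normal_prob 0 1.
have Pmu : P `<< mu := normal_prob_dominates 0 1.
have /measurable_EFinP mfE := mf.
have <- // := @Radon_Nikodym_SigmaFinite.change_of_variables _ _ _ P mu Pmu
  (EFin \o f) setT.
apply: ae_eq_integral => //.
- apply: emeasurable_funM => //.
  exact: measurable_int (Radon_Nikodym_SigmaFinite.f_integrable _).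
- by apply/measurable_EFinP; apply: measurable_funM => //; exact: measurable_phi.
- under [X in ae_eq _ _ _ X]eq_fun do rewrite EFinM.
  apply: ae_eqe_mul2l => /=.
  apply: integral_ae_eq => //.
  + exact: Radon_Nikodym_SigmaFinite.f_integrable.
  + by apply/measurable_EFinP; exact: measurable_phi.
  + move=> A _ mA; by rewrite -Radon_Nikodym_SigmaFinite.f_integral.
Qed.

Lemma gaussE_gauss_int (f : R -> R) : measurable_fun setT f ->
  (forall x, 0 <= f x) -> gaussE f = fine (gauss_int f).
Proof.
by move=> mf f0; rewrite /gaussE unlock gauss_int_normal_prob.
Qed.

Lemma ge0_integralT_affine (G : R -> R) (m s : R) : 0 < s -> continuous G ->
  (forall x, 0 <= G x) ->
  (\int[mu]_x (G x)%:E = \int[mu]_x (G (m + s * x) * s)%:E)%E.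
Proof.
move=> s0 cG G0; pose F x : R := m + s * x.
have dFx x : is_derive x 1 F s.
  by apply: is_derive_eq; rewrite /GRing.scale/=; ring.
have dF : derive1 F = cst s by apply/funext => x; rewrite derive1E derive_val.
rewrite (@increasing_ge0_integration_by_substitutionT _ F)//.
- by rewrite dF.
- by move=> x y xy; rewrite ltrD2l ltr_pM2l.
- by rewrite dF => x; exact: cvg_cst.
- by rewrite dF; exact: is_cvg_cst.
- by rewrite dF; exact: is_cvg_cst.
- apply: cvg_comp (cvg_addrl_Ny _). exact: gt0_cvgMrNy.
- apply: cvg_comp (cvg_addrl _). exact: gt0_cvgMry.
Qed.

Lemma ge0_integralT_split (G : R -> R) : measurable_fun setT G ->
  (forall x, 0 <= G x) ->
  (\int[mu]_x (G x)%:E = \int[mu]_(x in `]-oo, 0%R]) (G x)%:E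
    + \int[mu]_(x in `[0%R, +oo[) (G x)%:E)%E.
Proof.
move=> mG G0; rewrite -(setUv `]-oo, 0]%classic) ge0_integral_setU//=.
- rewrite setCitvl integral_itv_obnd_cbnd//.
  exact/measurable_EFinP/measurable_funTS.
- exact: measurableC.
- by rewrite setUv; exact/measurable_EFinP.
- by move=> x _; rewrite lee_fin.
- exact/disj_setPCl.
Qed.

Lemma ge0_integralT_oppr (G : R -> R) : continuous G -> (forall x, 0 <= G x) ->
  (\int[mu]_x (G (- x))%:E = \int[mu]_x (G x)%:E)%E.
Proof.
move=> cG G0; have cGN : continuous (fun x => G (- x)).
  by move=> x; apply: continuous_comp; [exact: opp_continuous|exact: cG].
rewrite !ge0_integralT_split//; [|exact: continuous_measurable_fun..].
rewrite addeC; congr (_ + _)%E.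
- have := @ge0_integration_by_substitutionNy R G 0; rewrite oppr0 => -> //.
  exact: continuous_subspaceT.
- have := @ge0_integration_by_substitutionNy R (fun x => G (- x)) 0.
  rewrite oppr0 => -> //.
    by apply: eq_integral => x _ /=; rewrite opprK.
  exact: continuous_subspaceT.
Qed.

Lemma measurable_gauss_integrand (f : R -> R) : measurable_fun setT f ->
  measurable_fun setT (fun x => (f x * phi x)%:E).
Proof.
move=> mf; apply/measurable_EFinP; apply: measurable_funM => //.
exact: measurable_phi.
Qed.

Lemma normal_pdf_affine (m s x : R) : 0 < s ->
  normal_pdf m s (m + s * x) * s = phi x.
Proof.
move=> s0; rewrite normal_pdfE ?gt_eqF// phiE phi0E /normal_peak /normal_fun.
rewrite -mulr_natl (mulrCA 2) sqrtrM ?sqr_ge0// sqrtr_sqr gtr0_norm// invfM.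
rewrite (_ : - _ / _ = - (x ^+ 2 / 2)).
  by move: (Num.sqrt (2 * pi))^-1 (expR _) => p e; field; rewrite gt_eqF.
by field; rewrite gt_eqF.
Qed.

Lemma normal_pdf_phi (m s x : R) : 0 < s ->
  normal_pdf m s x = phi ((x - m) / s) / s.
Proof.
move=> s0; have sn0 : s != 0 by rewrite gt_eqF.
rewrite -(normal_pdf_affine m _ s0) mulfK// mulrCA mulfV// mulr1.
by rewrite addrC subrK.
Qed.

(** Both sides are the density at (t, z) of a centred Gaussian pair with unit
variances and correlation r, disintegrated along either coordinate. *)
Lemma normal_pdf_rotation (r s z t : R) : 0 < s -> r ^+ 2 + s ^+ 2 = 1 ->
  phi t * normal_pdf (r * t) s z = phi z * normal_pdf (r * z) s t.
Proof.
move=> s0 rs; rewrite !normal_pdfE ?gt_eqF// (phiE t) (phiE z) /normal_fun.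
rewrite -!mulrA; congr (_ * _); rewrite mulrCA [RHS]mulrCA; congr (_ * _).
rewrite -!expRD; congr expR.
have r2 : r ^+ 2 = 1 - s ^+ 2 by rewrite -rs addrK.
rewrite [LHS](_ : _ = (- (t ^+ 2 * s ^+ 2 +
    (z ^+ 2 + r ^+ 2 * t ^+ 2 - 2 * r * t * z))) / (2 * s ^+ 2)); last first.
  by field; rewrite gt_eqF.
rewrite [RHS](_ : _ = (- (z ^+ 2 * s ^+ 2 +
    (t ^+ 2 + r ^+ 2 * z ^+ 2 - 2 * r * t * z))) / (2 * s ^+ 2)); last first.
  by field; rewrite gt_eqF.
rewrite r2; congr (_ / _); ring.
Qed.

(** If Z and W are independent standard normal variables and r^2 + s^2 = 1, then
r Z + s W is standard normal.  Inserting the total mass 1 of a normal density in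
z, exchanging the integrals and using the symmetry of the joint density turns
the integral over t into an average over z of integrals against normal laws of
mean r z and deviation s. *)
Lemma gauss_int_rotation (f : R -> R) (r s : R) : continuous f ->
  (forall x, 0 <= f x) -> 0 < s -> r ^+ 2 + s ^+ 2 = 1 ->
  (gauss_int f =
   \int[mu]_z (gauss_int (fun w => f (r * z + s * w)%R) * (phi z)%:E))%E.
Proof.
move=> cf f0 s0 rs; have mf := continuous_measurable_fun cf.
pose k (t z : R) : R := f t * (phi t * normal_pdf (r * t) s z).
have k0 t z : 0 <= k t z by rewrite !mulr_ge0 ?phi_ge0 ?normal_pdf_ge0.
have mk : measurable_fun [set: R * R] (fun p => k p.1 p.2).
  rewrite /k; apply: measurable_funM; first exact: measurableT_comp.
  apply: measurable_funM.
    by apply: measurableT_comp => //; exact: measurable_phi.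
  rewrite (_ : (fun _ => _) =
    (fun p => phi ((p.2 - r * p.1) / s) / s)); last first.
    by apply/funext => p; rewrite normal_pdf_phi.
  apply: measurable_funM => //; apply: measurableT_comp.
    exact: measurable_phi.
  apply: measurable_funM => //; apply: measurable_funB => //.
  exact: measurable_funM.
have -> : gauss_int f = (\int[mu]_t \int[mu]_z (k t z)%:E)%E.
  apply: eq_integral => t _; rewrite /k.
  under eq_integral do rewrite mulrA EFinM.
  rewrite ge0_integralZl//.
  - by rewrite integral_normal_pdf mule1.
  - by apply/measurable_EFinP; exact: measurable_normal_pdf.
  - by move=> z _; rewrite lee_fin normal_pdf_ge0.
  - by rewrite lee_fin mulr_ge0 ?phi_ge0.
have := @fubini_tonelli _ _ _ _ R mu mu (fun p => (k p.1 p.2)%:E).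
move=> /= -> //; last 2 first.
- exact/measurable_EFinP.
- by move=> ?; rewrite lee_fin.
apply: eq_integral => z _.
transitivity (\int[mu]_t (f t * normal_pdf (r * z) s t * phi z)%:E)%E.
  apply: eq_integral => t _; rewrite /k normal_pdf_rotation//.
  by rewrite [phi z * _]mulrC mulrA.
have cG : continuous (fun t => f t * normal_pdf (r * z) s t * phi z).
  move=> t; apply: cvgM; last exact: cvg_cst.
  apply: cvgM; first exact: cf.
  by apply: continuous_normal_pdf; rewrite gt_eqF.
rewrite (ge0_integralT_affine (r * z) s0 cG); last first.
  by move=> t; rewrite !mulr_ge0 ?phi_ge0 ?normal_pdf_ge0.
rewrite -ge0_integralZr//.
- apply: eq_integral => w _; rewrite -EFinM; congr EFin.
  by rewrite -(normal_pdf_affine (r * z) w s0); ring.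
- apply: measurable_gauss_integrand; apply: measurableT_comp => //.
  by apply: measurable_funD => //; exact: measurable_funM.
- by move=> w _; rewrite lee_fin mulr_ge0 ?phi_ge0.
- by rewrite lee_fin phi_ge0.
Qed.

Lemma gauss_int_oppr (f : R -> R) : continuous f -> (forall x, 0 <= f x) ->
  gauss_int (fun x => f (- x)) = gauss_int f.
Proof.
move=> cf f0; rewrite /gauss_int.
rewrite -(@ge0_integralT_oppr (fun x => f x * phi x)).
- by apply: eq_integral => x _; rewrite phiN.
- by move=> x; apply: cvgM; [exact: cf|exact: continuous_phi].
- by move=> x; rewrite mulr_ge0 ?phi_ge0.
Qed.

(** From exp (x^2 / 2) >= x^2 / 2. *)
Lemma cvg_id_phi : x * phi x @[x --> +oo] --> (0 : R).
Proof.
apply: (@squeeze_cvgr _ _ _ _ (fun=> 0) (fun x => tau / x)).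
- near=> x.
  have x0 : 0 < x by near: x; apply: nbhs_pinfty_gt; exact: num_real.
  rewrite mulr_ge0 ?phi_ge0 ?(ltW x0)//= ler_pdivlMr// phiE.
  have e0 := expR_gt0 (x ^+ 2 / 2).
  have := expR_ge1Dx (x ^+ 2 / 2); rewrite expRN => e1.
  have -> : x * (phi 0 / expR (x ^+ 2 / 2)) * x =
      phi 0 * (x ^+ 2 / expR (x ^+ 2 / 2)).
    by ring.
  by rewrite /tau mulrC ler_pM2r ?phi_gt0// ler_pdivrMr//; lra.
- exact: cvg_cst.
- rewrite -(mulr0 tau); apply: cvgMl_tmp.
  apply/gtr0_cvgV0; last exact: cvg_id.
  by apply: nbhs_pinfty_gt; exact: num_real.
Unshelve. all: end_near. Qed.

Lemma cvg_phi_pinfty : phi x @[x --> +oo] --> (0 : R).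
Proof.
apply: (@squeeze_cvgr _ _ _ _ (fun=> 0) (fun x => x * phi x)).
- near=> x.
  have x1 : 1 <= x by near: x; apply: nbhs_pinfty_ge; exact: num_real.
  by rewrite phi_ge0/= ler_peMl ?phi_ge0.
- exact: cvg_cst.
- exact: cvg_id_phi.
Unshelve. all: end_near. Qed.

(** The closed form of E[(u - Z)_+^2], see [gauss_int_gauss_pos_sqr]. *)
Definition gauss_pos_sqr u : R := (u ^+ 2 + 1) * Phi u + u * phi u.

Lemma gauss_pos_sqrN u : gauss_pos_sqr u + gauss_pos_sqr (- u) = u ^+ 2 + 1.
Proof. by rewrite /gauss_pos_sqr PhiN phiN; ring. Qed.

(** (u^2 + 1) Phi(w) - (2 u + w) phi(w) is an antiderivative of (u + w)^2 phi(w);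
the reflection w -> - w puts the half-line at +oo. *)
Lemma gauss_int_gauss_pos_sqr u :
  gauss_int (fun w => Num.max (u - w) 0 ^+ 2) = (gauss_pos_sqr u)%:E.
Proof.
have cm := @continuous_sqr_pos u.
rewrite -gauss_int_oppr//; last by move=> w; rewrite sqr_ge0.
pose h w := (u + w) ^+ 2 * phi w.
pose H w := (u ^+ 2 + 1) * Phi w - (2 * u * phi w + w * phi w).
have dH (w : R) : is_derive w 1 H (h w).
  by apply: is_derive_eq; rewrite /GRing.scale/= /h; ring.
have ch : continuous h.
  move=> w; apply: cvgM; last exact: continuous_phi.
  apply: (@continuous_comp _ _ _ (fun w => u + w) (fun x => x ^+ 2));
    last exact: exprn_continuous.
  by apply: cvgD; [exact: cvg_cst|exact: cvg_id].
have cH : continuous H.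
  by move=> w; exact: is_derive_continuous (dH w).
have -> : gauss_int (fun w => Num.max (u - - w) 0 ^+ 2) =
    (\int[mu]_(w in `[(- u)%R, +oo[) (h w)%:E)%E.
  rewrite [RHS]integral_mkcond; apply: eq_integral => w _.
  rewrite patchE; case: ifPn; rewrite opprK.
    by rewrite inE/= in_itv/= andbT -subr_ge0 opprK addrC => /max_idPl ->.
  rewrite notin_setE/= in_itv/= andbT => /negP.
  rewrite -ltNge -subr_gt0 -opprD oppr_gt0 addrC => /ltW/max_idPr ->.
  by rewrite expr0n/= mul0r.
rewrite (@ge0_continuous_FTC2y _ h H _ (u ^+ 2 + 1)).
- by rewrite -EFinB /H PhiN phiN /gauss_pos_sqr; congr EFin; ring.
- by move=> w _; rewrite mulr_ge0 ?sqr_ge0 ?phi_ge0.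
- exact: continuous_subspaceT.
- rewrite -[X in _ --> X](_ : (u ^+ 2 + 1) * 1 - (2 * u * 0 + 0) = _);
    last by ring.
  apply: cvgB; first by apply: cvgMl_tmp; exact: cvg_Phi_pinfty.
  apply: cvgD; last exact: cvg_id_phi.
  by apply: cvgMl_tmp; exact: cvg_phi_pinfty.
- by move=> w _; have := dH w => ?; exact: ex_derive.
- exact/cvg_at_right_filter/cH.
- by move=> w _; rewrite derive1E; have := dH w => ?; rewrite derive_val.
Qed.

(** * The lower bound on r (1 - q)^2 *)

Lemma gauss_pos_sqr_ge0 u : 0 <= gauss_pos_sqr u.
Proof.
rewrite -lee_fin -gauss_int_gauss_pos_sqr; apply: integral_ge0 => w _.
by rewrite lee_fin mulr_ge0 ?sqr_ge0 ?phi_ge0.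
Qed.

Lemma gauss_pos_sqr_gt0 u : 0 <= u -> 0 < gauss_pos_sqr u.
Proof.
move=> u0; apply: ltr_pwDl; last by rewrite mulr_ge0 ?phi_ge0.
by rewrite mulr_gt0 ?Phi_gt0// ltr_wpDl ?sqr_ge0.
Qed.

(** Write c for [gauss_pos_sqr].  For u >= 4/5 the bound
c(u) <= c(u) + c(-u) = u^2 + 1 suffices.  Below 4/5, Phi(u) <= 1/2 + phi(0) u
and phi <= phi(0) bound c(u) by a cubic polynomial, which is compared with the
square of the tangent line. *)
Lemma gauss_pos_sqr_le_invMills u : 0 <= u -> gauss_pos_sqr u <= invMills u ^+ 2.
Proof.
move=> u0; have [u45|/ltW u45] := leP u (4 / 5); last first.
  apply: le_trans (invMills_sqr_ge u45).
  by have := gauss_pos_sqr_ge0 (- u); have := gauss_pos_sqrN u; lra.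
have t2 := tau2_ge; have t1 := tau_le1; have t0 := tau_ge.
apply: le_trans (invMills_sqr_ge_tangent _); last by lra.
have phile x : phi x <= tau / 2.
  by rewrite /tau mulrC mulKf//; apply: phi_le; rewrite normr0.
have Phile : Phi u <= 1 / 2 + tau / 2 * u.
  have [c _] := mean_value u0 (fun x _ => is_derive_Phi x).
  by rewrite Phi0 subr0 => e; have := ler_wpM2r u0 (phile c); lra.
have : gauss_pos_sqr u <= (u ^+ 2 + 1) * (1 / 2 + tau / 2 * u) + u * (tau / 2).
  by rewrite /gauss_pos_sqr lerD// ler_wpM2l// addr_ge0// sqr_ge0.
move=> /le_trans; apply.
(* AM-GM at 4/5, which is close to the true value of tau: this makes the
   remaining inequality affine in tau ^+ 2. *)
have tle : tau <= (tau ^+ 2 + 16 / 25) * (5 / 8).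
  by have := sqr_ge0 (tau - 4 / 5); lra.
have t0' : 0 <= tau by lra.
have h1 : 25 / 64 * u ^+ 2 <= (tau ^+ 2) ^+ 2 * u ^+ 2.
  by apply: ler_wpM2r; [rewrite sqr_ge0|nra].
have h2 : tau * u * (1 / 4) <= tau * u * (2 * tau ^+ 2 - 1).
  by apply: ler_wpM2l; [rewrite mulr_ge0|lra].
have u2 : u ^+ 2 <= 16 / 25 by nra.
have h3 : 1 / 2 - tau ^+ 2 + 7 / 64 * u ^+ 2 <= tau * (u / 4 - u ^+ 3 / 2).
  have u3 : u ^+ 3 = u ^+ 2 * u by ring.
  have [v0|/ltW v0] := leP 0 (u / 4 - u ^+ 3 / 2).
    have := mulr_ge0 t0' v0.
    have : u ^+ 2 <= 16 / 25 by nra.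
    lra.
  (* u / 4 - u ^+ 3 / 2 decreases where it is negative, and it equals
     - 56 / 1000 at u = 4 / 5. *)
  have v1 : - (56 / 1000) <= u / 4 - u ^+ 3 / 2 by nra.
  have := ler_wnM2r v0 tle.
  nra.
nra.
Qed.

Lemma continuous_gauss_pos_sqr : continuous gauss_pos_sqr.
Proof.
move=> u; apply: cvgD; apply: cvgM.
- by apply: cvgD; [exact: exprn_continuous|exact: cvg_cst].
- exact: continuous_Phi.
- exact: cvg_id.
- exact: continuous_phi.
Qed.

Lemma continuous_invMills : continuous (@invMills R).
Proof.
move=> u; apply: cvgM; first exact: continuous_phi.
apply: cvgV; first by rewrite gt_eqF// Phibar_gt0.
by apply: cvgB; [exact: cvg_cst|exact: continuous_Phi].
Qed.

(** The involution z -> 2 k / r - z changes the sign of X = k - r z.  When X >= 0,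
the point z is the one closer to 0 because k >= 0, so it carries the larger
density; the excess of h over c at X then outweighs its possible deficit at
- X. *)
Lemma gauss_int_le_fold (c h : R -> R) (k r : R) : 0 <= k -> 0 <= r ->
  continuous c -> continuous h ->
  (forall x, 0 <= c x) -> (forall x, 0 <= h x) ->
  (forall x, 0 <= x -> c x <= h x) ->
  (forall x, 0 <= x -> c x + c (- x) <= h x + h (- x)) ->
  (gauss_int (fun z => c (k - r * z)%R) <=
   gauss_int (fun z => h (k - r * z)%R))%E.
Proof.
move=> k0 + cc ch c0 h0 A B; rewrite le_eqVlt => /predU1P[<-|r0].
  apply: ge0_le_integral => //.
  - by move=> z _; rewrite lee_fin mulr_ge0 ?phi_ge0.
  - apply: measurable_gauss_integrand; apply: measurableT_comp.
      exact: continuous_measurable_fun.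
    by apply: measurable_funB => //; exact: measurable_funM.
  - apply: measurable_gauss_integrand; apply: measurableT_comp.
      exact: continuous_measurable_fun.
    by apply: measurable_funB => //; exact: measurable_funM.
  - by move=> z _; rewrite lee_fin ler_wpM2r ?phi_ge0// mul0r subr0 A.
pose m := 2 * k / r.
have m0 : 0 <= m by rewrite divr_ge0 ?mulr_ge0// ltW.
have aff z : k - r * (m - z) = - (k - r * z).
  by rewrite /m; field; rewrite gt_eqF.
have cX (f : R -> R) : continuous f ->
    continuous (fun z => f (k - r * z) * phi z).
  move=> cf z; apply: cvgM; last exact: continuous_phi.
  apply: (@continuous_comp _ _ _ (fun z => k - r * z) f); last exact: cf.
  apply: cvgB; first exact: cvg_cst.
  by apply: cvgMl_tmp; exact: cvg_id.
have fold (f : R -> R) : continuous f -> (forall x, 0 <= f x) ->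
    (gauss_int (fun z => f (k - r * z)%R) +
     gauss_int (fun z => f (k - r * z)%R) =
    \int[mu]_z (f (k - r * z) * phi z + f (- (k - r * z)) * phi (m - z))%:E)%E.
  move=> cf f0; pose G z := f (k - r * z) * phi z.
  have G0 z : 0 <= G z by rewrite mulr_ge0 ?phi_ge0.
  have cG : continuous G by exact: cX.
  have cGm : continuous (fun z => G (m + z)).
    move=> z; apply: (@continuous_comp _ _ _ (fun z => m + z) G); last exact: cG.
    by apply: cvgD; [exact: cvg_cst|exact: cvg_id].
  have cGN : continuous (fun z => G (m - z)).
    move=> z; apply: (@continuous_comp _ _ _ (fun z => m - z) G); last exact: cG.
    by apply: cvgB; [exact: cvg_cst|exact: cvg_id].
  have refl : (\int[mu]_z (G (m - z))%:E = \int[mu]_z (G z)%:E)%E.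
    rewrite (ge0_integralT_oppr cGm)//.
    rewrite [RHS](ge0_integralT_affine m ltr01)//.
    by apply: eq_integral => z _; rewrite mul1r mulr1.
  rewrite [in X in (_ + X)%E](_ : gauss_int _ =
    \int[mu]_z (G (m - z)%R)%:E)%E; last first.
    by rewrite refl.
  rewrite -ge0_integralD//.
  - by apply: eq_integral => z _; rewrite -EFinD /G aff.
  - by move=> z _; rewrite lee_fin G0.
  - by apply/measurable_EFinP; exact: continuous_measurable_fun.
  - by move=> z _; rewrite lee_fin G0.
  - by apply/measurable_EFinP; exact: continuous_measurable_fun.
(* Doubling both integrals allows each to be folded. *)
rewrite leNgt; apply/negP => lt; have := lteD lt lt.
rewrite !fold// ltNge => /negP; apply.
have mint (f : R -> R) : continuous f ->
  measurable_fun setT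
    (fun z => (f (k - r * z) * phi z + f (- (k - r * z)) * phi (m - z))%:E).
  move=> cf; apply/measurable_EFinP; apply: measurable_funD.
    by apply: continuous_measurable_fun; exact: cX.
  apply: measurable_funM.
    apply: measurableT_comp; first exact: continuous_measurable_fun.
    apply: measurableT_comp => //.
    by apply: measurable_funB => //; exact: measurable_funM.
  apply: measurableT_comp; first exact: measurable_phi.
  exact: measurable_funB.
apply: ge0_le_integral => //.
- by move=> z _; rewrite lee_fin addr_ge0 ?mulr_ge0 ?phi_ge0.
- exact: mint.
- exact: mint.
move=> z _; rewrite lee_fin.
have key (x p p' : R) : 0 <= x -> 0 <= p' -> p' <= p ->
    c x * p + c (- x) * p' <= h x * p + h (- x) * p'.
  move=> x0 p0 pp; have := A x x0; have := B x x0.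
  have := c0 x; have := h0 x; nra.
have rm : r * m = 2 * k by rewrite /m mulrC divfK// gt_eqF.
have zm : r * (m - z - z) = 2 * (k - r * z) by rewrite !mulrBr rm; ring.
have [X0|X0] := leP 0 (k - r * z).
  apply: key => //; first exact: phi_ge0.
  apply: phi_le; apply: le_trans (ler_norm _); rewrite ler_norml.
  apply/andP; split; first by lra.
  by rewrite -subr_ge0 -(pmulr_rge0 _ r0) zm mulr_ge0.
rewrite addrC [leRHS]addrC; have := @key (- (k - r * z)) (phi (m - z)) (phi z).
rewrite opprK; apply; first by lra.
  exact: phi_ge0.
apply: phi_le; apply: le_trans (ler_norm _); rewrite ler_norml.
apply/andP; split; first by lra.
rewrite -subr_le0 -(pmulr_rle0 _ r0) zm; lra.
Qed.

(** Here (1 - q)^2 F_q^2 = s^2 M(X/s)^2 with M = [invMills] and s = sqrt (1 - q); the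
left-hand side is E[s^2 c(X/s)] by rotation invariance, where X = kappa - sqrt q Z and c
is [gauss_pos_sqr]. *)
Lemma gauss_pos_sqr_le_gauss_int (kappa q : R) : 0 <= kappa -> 0 <= q < 1 ->
  ((gauss_pos_sqr kappa)%:E <=
   gauss_int (fun z => (1 - q) ^+ 2 * Fq kappa q (Num.sqrt q * z) ^+ 2)%R)%E.
Proof.
move=> k0 /andP[q0 q1]; have q1' : 0 < 1 - q by rewrite subr_gt0.
pose s : R := Num.sqrt (1 - q); pose r : R := Num.sqrt q.
have s0 : 0 < s by rewrite sqrtr_gt0.
have s2 : s ^+ 2 = 1 - q by rewrite sqr_sqrtr// ltW.
have rs : r ^+ 2 + s ^+ 2 = 1 by rewrite s2 sqr_sqrtr// addrC subrK.
have sn0 : s != 0 by rewrite gt_eqF.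
rewrite -gauss_int_gauss_pos_sqr (gauss_int_rotation _ _ s0 rs); last 2 first.
- exact: continuous_sqr_pos.
- by move=> w; rewrite sqr_ge0.
pose c x : R := s ^+ 2 * gauss_pos_sqr x.
pose h x : R := s ^+ 2 * invMills x ^+ 2.
have -> : (\int[mu]_z
    (gauss_int (fun w => (Num.max (kappa - (r * z + s * w)) 0 ^+ 2)%R) *
     (phi z)%:E) = gauss_int (fun z => c (kappa / s - r / s * z)%R))%E.
  apply: eq_integral => z _; rewrite [RHS]EFinM; congr (_ * _)%E.
  rewrite /c EFinM -gauss_int_gauss_pos_sqr -ge0_integralZl//.
  - apply: eq_integral => w _; rewrite -EFinM mulrA -exprMn.
    congr EFin; congr (_ ^+ _ * _).
    rewrite maxr_pMr ?(ltW s0)// mulr0; congr Num.max.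
    by field.
  - apply: measurable_gauss_integrand; apply: measurable_funX.
    by apply: measurable_maxr => //; exact: measurable_funB.
  - by move=> w _; rewrite lee_fin mulr_ge0 ?sqr_ge0 ?phi_ge0.
  - by rewrite lee_fin sqr_ge0.
apply: (@le_trans _ _ (gauss_int (fun z => h (kappa / s - r / s * z)))).
  apply: gauss_int_le_fold.
  - by rewrite divr_ge0 ?(ltW s0).
  - by rewrite divr_ge0 ?sqrtr_ge0 ?(ltW s0).
  - by move=> x; apply: cvgMl_tmp; exact: continuous_gauss_pos_sqr.
  - move=> x; apply: cvgMl_tmp.
    apply: (@continuous_comp _ _ _ (@invMills R) (fun x => x ^+ 2));
      last exact: exprn_continuous.
    exact: continuous_invMills.
  - by move=> x; rewrite mulr_ge0 ?sqr_ge0 ?gauss_pos_sqr_ge0.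
  - by move=> x; rewrite mulr_ge0 ?sqr_ge0.
  - by move=> x x0; rewrite ler_wpM2l ?sqr_ge0 ?gauss_pos_sqr_le_invMills.
  - move=> x x0; rewrite -!mulrDr ler_wpM2l ?sqr_ge0//.
    by rewrite gauss_pos_sqrN invMills_sqrN.
rewrite le_eqVlt; apply/orP; left; apply/eqP; apply: eq_integral => z _.
congr EFin; congr (_ * _); rewrite /h /Fq -/s -/r -s2.
rewrite (_ : kappa / s - r / s * z = (kappa - r * z) / s); last by field.
by move: (invMills _) => a; field.
Qed.

Lemma gauss_int_cst (a : R) : gauss_int (fun=> a) = a%:E.
Proof.
rewrite /gauss_int; under eq_integral do rewrite EFinM.
rewrite integralZl//; last exact: integrable_normal_pdf.
by rewrite integral_normal_pdf mule1.
Qed.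

Lemma measurable_Fq (kappa q : R) :
  measurable_fun setT (fun z => Fq kappa q (Num.sqrt q * z) ^+ 2).
Proof.
apply: measurable_funX; apply: measurable_funM => //.
apply: measurableT_comp.
  by apply: continuous_measurable_fun; exact: continuous_invMills.
apply: measurable_funM => //; apply: measurable_funB => //.
Qed.

Lemma R_map_ge (kappa alpha q r : R) : 0 <= kappa -> 0 < alpha ->
  is_solution kappa alpha q r ->
  alpha * gauss_pos_sqr kappa <= r * (1 - q) ^+ 2.
Proof.
move=> k0 a0 [/[dup] q01 /andP[q0 q1] r0 qP rR].
pose I := gauss_int (fun z => Fq kappa q (Num.sqrt q * z) ^+ 2).
have gE : gaussE (fun z => Fq kappa q (Num.sqrt q * z) ^+ 2) = fine I.
  rewrite gaussE_gauss_int//; first exact: measurable_Fq.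
  by move=> z; rewrite sqr_ge0.
have I0 : (0 <= I)%E.
  by apply: integral_ge0 => z _; rewrite lee_fin mulr_ge0 ?sqr_ge0 ?phi_ge0.
(* Were the expectation infinite, [fine] would give r = 0, hence q = P(0) = 0,
   and the integrand would be constant. *)
have Ifin : I \is a fin_num.
  rewrite ge0_fin_numE// ltey; apply/eqP => Iy.
  have r00 : r = 0 by rewrite rR /R_map gE Iy/= mulr0.
  have q00 : q = 0.
    rewrite qP r00 /P_map gaussE_gauss_int.
    - rewrite (_ : (fun _ => _) = cst 0) ?gauss_int_cst//.
      by apply/funext => z; rewrite sqrtr0 mul0r /tanh oppr0 subrr mul0r expr0n.
    - rewrite (_ : (fun _ => _) = cst 0)//.
      by apply/funext => z; rewrite sqrtr0 mul0r /tanh oppr0 subrr mul0r expr0n.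
    - by move=> z; rewrite sqr_ge0.
  move: Iy; rewrite /I q00 (_ : (fun _ => _) = cst (Fq kappa 0 0 ^+ 2)).
    by rewrite gauss_int_cst.
  by apply/funext => z; rewrite sqrtr0 mul0r.
have := gauss_pos_sqr_le_gauss_int k0 q01.
have -> : (gauss_int (fun z => (1 - q) ^+ 2 * Fq kappa q (Num.sqrt q * z) ^+ 2)%R
    = ((1 - q) ^+ 2)%:E * I)%E.
  rewrite -ge0_integralZl//.
  - apply: eq_integral => z _; rewrite -EFinM; congr EFin.
    exact: esym (mulrA _ _ _).
  - by apply: measurable_gauss_integrand; exact: measurable_Fq.
  - by move=> w _; rewrite lee_fin mulr_ge0 ?sqr_ge0 ?phi_ge0.
  - by rewrite lee_fin sqr_ge0.
rewrite -(fineK Ifin) -EFinM lee_fin => le.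
rewrite rR /R_map gE -mulrA ler_pM2l// mulrC; exact: le.
Qed.

Lemma CkappaE (kappa : R) : Ckappa kappa = gauss_pos_sqr kappa.
Proof.
rewrite /Ckappa gaussE_gauss_int ?gauss_int_gauss_pos_sqr//.
  by apply: continuous_measurable_fun; exact: continuous_sqr_pos.
by move=> z; rewrite sqr_ge0.
Qed.

(** * The equation q = P(r) *)

Let cosh_gt0 x : 0 < expR x + expR (- x).
Proof. by rewrite addr_gt0 ?expR_gt0. Qed.

Lemma is_derive_tanh x : is_derive x 1 tanh (1 - tanh x ^+ 2).
Proof.
have n0 : expR x + expR (- x) != 0 by rewrite gt_eqF ?cosh_gt0.
have d1 : is_derive x 1 (fun y : R => expR y + expR (- y)) (expR x - expR (- x)).
  by apply: is_derive_eq; rewrite /GRing.scale/=; ring.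
have d2 : is_derive x 1 (fun y : R => expR y - expR (- y)) (expR x + expR (- x)).
  by apply: is_derive_eq; rewrite /GRing.scale/=; ring.
have dV := @is_deriveV _ (fun y : R => expR y + expR (- y)) x _ 1 n0 d1.
have := is_deriveM d2 dV.
move=> /is_derive_eq; apply; rewrite /GRing.scale/= /Defs.tanh.
by move: (expR x) (expR (- x)) n0 => a b n0; field.
Qed.

Lemma tanhN x : tanh (- x) = - tanh x.
Proof.
by rewrite /Defs.tanh opprK -mulNr opprB; congr (_ / _); exact: addrC.
Qed.

Lemma tanh0 : tanh 0 = 0.
Proof. by rewrite /Defs.tanh oppr0 subrr mul0r. Qed.

Lemma onem_tanhE x : 1 - tanh x = 2 * expR (- x) / (expR x + expR (- x)).
Proof.
have n0 : expR x + expR (- x) != 0 by rewrite gt_eqF ?cosh_gt0.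
by rewrite /Defs.tanh; move: (expR x) (expR (- x)) n0 => a b n0; field.
Qed.

Lemma tanh_lt1 x : tanh x < 1.
Proof. by rewrite -subr_gt0 onem_tanhE divr_gt0 ?cosh_gt0 ?mulr_gt0 ?expR_gt0. Qed.

Lemma tanh_sqr_le1 x : tanh x ^+ 2 <= 1.
Proof.
rewrite -real_normK ?num_real// expr_le1// ler_norml (ltW (tanh_lt1 x)) andbT.
by rewrite lerNl -tanhN (ltW (tanh_lt1 _)).
Qed.

Lemma tanh_le x y : x <= y -> tanh x <= tanh y.
Proof.
move=> xy; apply: ndecr_is_derive xy (fun z _ => is_derive_tanh z) _ => z _.
by rewrite subr_ge0 tanh_sqr_le1.
Qed.

Lemma tanh_ge0 x : 0 <= x -> 0 <= tanh x.
Proof. by move=> x0; rewrite -(tanh0) tanh_le. Qed.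

Lemma continuous_tanh : continuous tanh.
Proof.
by move=> x; exact: is_derive_continuous (is_derive_tanh x).
Qed.

Lemma cvg_tanh_pinfty : tanh x @[x --> +oo] --> (1 : R).
Proof.
rewrite -[X in _ --> X](subr0 (1 : R)).
rewrite (_ : tanh = fun x => 1 - (1 - tanh x)); last first.
  by apply/funext => x; rewrite opprB addrC subrK.
apply: cvgB; first exact: cvg_cst.
apply: (@squeeze_cvgr _ _ _ _ (fun=> 0) (fun x => 2 * expR (- x))).
- near=> x.
  have x0 : 0 <= x by near: x; apply: nbhs_pinfty_ge; exact: num_real.
  rewrite subr_ge0 (ltW (tanh_lt1 _))/= onem_tanhE ler_pdivrMr//.
  rewrite ler_peMr ?mulr_ge0 ?expR_ge0//.
  by apply: ler_wpDr; [exact: expR_ge0|rewrite -expR0 ler_expR].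
- exact: cvg_cst.
- by rewrite -(mulr0 2); apply: cvgMl_tmp; exact: cvgr_expR.
Unshelve. all: end_near. Qed.

Lemma continuous_tanh_sqr (p : R) : continuous (fun x => tanh (p * x) ^+ 2).
Proof.
move=> x; apply: (@continuous_comp _ _ _ (fun x => tanh (p * x))
  (fun x => x ^+ 2)); last exact: exprn_continuous.
apply: (@continuous_comp _ _ _ (fun x => p * x) tanh).
  by apply: cvgMl_tmp; exact: cvg_id.
exact: continuous_tanh.
Qed.

Section sech_squared.
Variables (p : R) (p0 : 0 < p).

Let S x := p * (1 - tanh (p * x) ^+ 2).

Let S_ge0 x : 0 <= S x.
Proof. by rewrite mulr_ge0 ?(ltW p0)// subr_ge0 tanh_sqr_le1. Qed.

Let continuous_S : continuous S.
Proof.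
move=> x; apply: cvgMl_tmp; apply: cvgB; first exact: cvg_cst.
exact: continuous_tanh_sqr.
Qed.

Let integral_S a :
  (\int[mu]_(x in `[a, +oo[) (S x)%:E = (1 - tanh (p * a))%:E)%E.
Proof.
have dT x : is_derive x 1 (fun y => tanh (p * y)) (S x).
  have d1 : is_derive x 1 (fun y : R => p * y) p.
    by apply: is_derive_eq; rewrite /GRing.scale/=; ring.
  have := is_derive1_comp (is_derive_tanh (p * x)) d1.
  by move=> /is_derive_eq; apply; rewrite mulrC.
rewrite (@ge0_continuous_FTC2y _ S (fun y => tanh (p * y)) _ 1)//.
- exact: continuous_subspaceT.
- apply: cvg_comp cvg_tanh_pinfty; apply: gt0_cvgMry => //; exact: cvg_id.
- apply: cvg_at_right_filter.
  exact: is_derive_continuous (dT a).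
- by move=> w _; rewrite derive1E; have := dT w => ?; rewrite derive_val.
Qed.

(** On the half-line, phi(x) <= phi(0) - (phi(0) - phi(1)) 1_(x >= 1), and S is
the derivative of tanh (p x), which increases by 1 on [0, +oo[ and by
1 - tanh p on [1, +oo[. *)
Lemma integral_sech2_phi_le :
  (gauss_int (fun x => p * (1 - tanh (p * x) ^+ 2))%R
    <= (tau - 2 * (phi 0 - phi 1) * (1 - tanh p))%:E)%E.
Proof.
have mS : measurable_fun setT S by exact: continuous_measurable_fun.
have cSphi : continuous (fun x => S x * phi x).
  by move=> x; apply: cvgM; [exact: continuous_S|exact: continuous_phi].
have mSphi : measurable_fun setT (fun x => S x * phi x).
  exact: continuous_measurable_fun.
have d0 : 0 <= phi 0 - phi 1 by rewrite subr_ge0 phi_le// normr0.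
rewrite /gauss_int ge0_symfun_integralT//; first last.
- by move=> x /=; rewrite /S mulrN tanhN sqrrN phiN.
- by move=> x; rewrite mulr_ge0 ?S_ge0 ?phi_ge0.
rewrite -set_itvcy.
pose D : set R := `[0%R, +oo[%classic.
have mD : measurable D by exact: measurable_itv.
pose g : R -> \bar R := (fun x => ((phi 0 - phi 1) * S x)%:E) \_ `[1%R, +oo[.
have mg : measurable_fun setT g.
  apply/(measurable_restrictT _ (measurable_itv _)); apply: measurable_funTS.
  by apply/measurable_EFinP; exact: measurable_funM.
have g0 x : (0 <= g x)%E.
  by rewrite /g patchE; case: ifPn => // _; rewrite lee_fin mulr_ge0 ?S_ge0.
have gE : (\int[mu]_(x in D) g x = ((phi 0 - phi 1) * (1 - tanh p))%:E)%E.
  rewrite /g -integral_mkcondr (_ : D `&` _ = `[1%R, +oo[%classic); last first.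
    apply/seteqP; split => x /=; rewrite !in_itv/= !andbT; first by case.
    by move=> x1; split => //; rewrite /D/= in_itv/= andbT (le_trans _ x1).
  have := integral_S 1; rewrite mulr1 EFinM => <-; rewrite -ge0_integralZl//.
  - by apply/measurable_EFinP; exact: measurable_funTS.
  - by move=> x _; rewrite lee_fin S_ge0.
have H : (\int[mu]_(x in D) (S x * phi x)%:E +
    ((phi 0 - phi 1) * (1 - tanh p))%:E <= (phi 0)%:E)%E.
  rewrite -gE -ge0_integralD//; last 2 first.
  - by apply/measurable_EFinP; exact: measurable_funTS.
  - exact: measurable_funTS.
  have -> : (phi 0)%:E = (\int[mu]_(x in D) (phi 0 * S x)%:E)%E.
    under eq_integral do rewrite EFinM.
    rewrite ge0_integralZl//.
    - by rewrite integral_S mulr0 tanh0 subr0 mule1.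
    - by apply/measurable_EFinP; exact: measurable_funTS.
    - by move=> x _; rewrite lee_fin S_ge0.
    - by rewrite lee_fin phi_ge0.
  apply: ge0_le_integral => //.
  - by move=> x _; rewrite adde_ge0 ?g0// lee_fin mulr_ge0 ?S_ge0 ?phi_ge0.
  - apply: emeasurable_funD => //.
      by apply/measurable_EFinP; exact: measurable_funTS.
    exact: measurable_funTS.
  - by apply/measurable_EFinP; apply: measurable_funTS; exact: measurable_funM.
  - move=> x Dx; rewrite /g patchE; case: ifPn.
      rewrite inE/= in_itv/= andbT => x1; rewrite -EFinD lee_fin.
      have : phi x <= phi 1 by rewrite phi_le// normr1 (le_trans x1)// ler_norm.
      by have := S_ge0 x; nra.
    move=> _; rewrite adde0 lee_fin mulrC ler_wpM2r ?S_ge0// phi_le// normr0.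
    exact: normr_ge0.
  by move=> x _; rewrite lee_fin mulr_ge0 ?S_ge0 ?phi_ge0.
move: H; rewrite -/D; set J := (\int[mu]_(x in D) _)%E => H.
have J0 : (0 <= J)%E.
  by apply: integral_ge0 => x _; rewrite lee_fin mulr_ge0 ?S_ge0 ?phi_ge0.
have Jfin : J \is a fin_num.
  rewrite ge0_fin_numE//; apply: le_lt_trans (ltry (phi 0)).
  apply: le_trans H; rewrite leeDl// lee_fin mulr_ge0// subr_ge0 ltW//.
  exact: tanh_lt1.
by move: H; rewrite -/J -(fineK Jfin) -EFinD -EFinM !lee_fin /tau; lra.
Qed.
End sech_squared.

Lemma P_map_gap r : 0 <= r ->
  Num.sqrt r * (1 - P_map r) <=
    tau - 2 * (phi 0 - phi 1) * (1 - tanh (Num.sqrt r)).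
Proof.
move=> r0; set p := Num.sqrt r.
have := sqrtr_ge0 r; rewrite -/p le_eqVlt => /predU1P[<-|p0].
  by rewrite mul0r tanh0 /tau; have := phi_gt0 (1 : R); lra.
pose f z := tanh (p * z) ^+ 2.
have cf : continuous f by exact: continuous_tanh_sqr.
have mf : measurable_fun setT f := continuous_measurable_fun cf.
have f0 z : 0 <= f z by rewrite sqr_ge0.
have f1 z : 0 <= 1 - f z by rewrite subr_ge0 tanh_sqr_le1.
have m1f : measurable_fun setT (fun z => 1 - f z) by exact: measurable_funB.
have sum : (gauss_int f + gauss_int (fun z => 1 - f z)%R = 1)%E.
  rewrite -ge0_integralD//; last 4 first.
  - by move=> z _; rewrite lee_fin mulr_ge0 ?phi_ge0.
  - exact: measurable_gauss_integrand.
  - by move=> z _; rewrite lee_fin mulr_ge0 ?phi_ge0.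
  - exact: measurable_gauss_integrand.
  rewrite -(integral_normal_pdf (0 : R) 1); apply: eq_integral => z _.
  by rewrite -EFinD -mulrDl addrC subrK mul1r.
have g0 (h : R -> R) : (forall z, 0 <= h z) -> (0 <= gauss_int h)%E.
  by move=> h0; apply: integral_ge0 => z _; rewrite lee_fin mulr_ge0 ?phi_ge0.
have fin1 : gauss_int f \is a fin_num.
  rewrite ge0_fin_numE ?g0//; apply: le_lt_trans (ltry 1).
  by rewrite -sum leeDl ?g0.
have fin2 : gauss_int (fun z => 1 - f z) \is a fin_num.
  rewrite ge0_fin_numE ?g0//; apply: le_lt_trans (ltry 1).
  by rewrite -sum leeDr ?g0.
have -> : 1 - P_map r = fine (gauss_int (fun z => 1 - f z)).
  rewrite /P_map gaussE_gauss_int//.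
  by move: sum; rewrite -(fineK fin1) -(fineK fin2) -EFinD => -[]; lra.
rewrite -lee_fin EFinM fineK//; apply: le_trans (integral_sech2_phi_le p0).
rewrite -ge0_integralZl//.
- rewrite le_eqVlt; apply/orP; left; apply/eqP; apply: eq_integral => z _.
  by rewrite -EFinM; congr EFin; exact: mulrA.
- exact: measurable_gauss_integrand.
- by move=> z _; rewrite lee_fin mulr_ge0 ?phi_ge0.
- by rewrite lee_fin ltW.
Qed.

(** * The critical value *)

Lemma alpha_cE (kappa : R) : 0 <= kappa ->
  alpha_c kappa = tau ^+ 2 / gauss_pos_sqr kappa.
Proof. by move=> k0; rewrite /alpha_c CkappaE tau2E invfM mulrA. Qed.

End fixed_point.

Theorem theorem2 (R : realType) (kappa : R) (kappa_ge0 : 0 <= kappa)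
    (q_ r_ : R -> R)
    (qr_sol : forall alpha : R, 0 < alpha < alpha_c kappa ->
       is_solution kappa alpha (q_ alpha) (r_ alpha)) :
  (q_ alpha @[alpha --> (alpha_c kappa)^'-] --> (1 : R)) /\
  (r_ alpha @[alpha --> (alpha_c kappa)^'-] --> +oo).
Proof.
have C0 := gauss_pos_sqr_gt0 kappa_ge0; set C := gauss_pos_sqr kappa in C0.
have t0 : 0 < tau :> R by apply: lt_le_trans (tau_ge); lra.
have ac0 : 0 < alpha_c kappa by rewrite alpha_cE// divr_gt0 ?exprn_gt0.
have near_dom : \forall a \near (alpha_c kappa)^'-, 0 < a < alpha_c kappa.
  near=> a; apply/andP; split; near: a.
    exact: nbhs_left_gt.
  exact: nbhs_left_lt.
have d0 : 0 < phi 0 - phi 1 :> R.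
  by rewrite subr_gt0 (phiE 1) gtr_pMr ?phi_gt0// expR_lt1; lra.
(* If r stayed below M, then r (1 - q)^2 would stay below B ^+ 2, where
   B < tau, so that alpha would stay below B ^+ 2 / C < alpha_c. *)
have r_oo : r_ alpha @[alpha --> (alpha_c kappa)^'-] --> +oo.
  apply/cvgryPge => M.
  pose B : R := tau - 2 * (phi 0 - phi 1) * (1 - tanh (Num.sqrt M)).
  have Bt : B < tau.
    by rewrite ltrBlDr ltrDl !mulr_gt0// subr_gt0 tanh_lt1.
  have B0 : 0 < B.
    have := tanh_ge0 (sqrtr_ge0 M); have := phi_gt0 (1 : R).
    rewrite /B /tau; nra.
  have BC : B ^+ 2 / C < alpha_c kappa.
    by rewrite alpha_cE// ltr_pM2r ?invr_gt0// ltrXn2r// ?nnegrE ltW.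
  near=> a; rewrite leNgt; apply/negP => rM.
  have adom : 0 < a < alpha_c kappa by near: a.
  have aB : B ^+ 2 / C < a by near: a; exact: nbhs_left_gt.
  have sol := qr_sol a adom; have [a0 _] := andP adom.
  have aC := R_map_ge kappa_ge0 a0 sol.
  case: sol => /andP[_ q1] r0 qP _.
  have := P_map_gap r0; rewrite -qP => yB.
  have yB' : Num.sqrt (r_ a) * (1 - q_ a) <= B.
    apply: le_trans yB _.
    rewrite lerD2l lerN2 ler_wpM2l ?lerB ?mulr_ge0 ?(ltW d0)//.
    by rewrite tanh_le// ler_wsqrtr// ltW.
  have : (Num.sqrt (r_ a) * (1 - q_ a)) ^+ 2 <= B ^+ 2.
    have y0 : 0 <= Num.sqrt (r_ a) * (1 - q_ a).
      by rewrite mulr_ge0 ?sqrtr_ge0 ?subr_ge0 ?(ltW q1).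
    by rewrite lerXn2r ?nnegrE ?(ltW B0).
  rewrite exprMn sqr_sqrtr// => /(le_trans aC).
  by rewrite leNgt -ltr_pdivrMr// aB.
split=> //; apply/cvgrPdist_le => e e0.
near=> a.
have adom : 0 < a < alpha_c kappa by near: a.
have [/andP[_ q1] r0 qP _] := qr_sol a adom.
have rge : (tau / e) ^+ 2 <= r_ a by near: a; move/cvgryPge : r_oo; apply.
have te : tau / e <= Num.sqrt (r_ a).
  by rewrite -(ler_sqrt _ r0) sqrtr_sqr gtr0_norm ?divr_gt0 in rge.
rewrite ger0_norm ?subr_ge0 ?(ltW q1)//.
have := P_map_gap r0; rewrite -qP => yB.
have yt : Num.sqrt (r_ a) * (1 - q_ a) <= tau.
  apply: le_trans yB _; rewrite gerBl !mulr_ge0 ?(ltW d0)//.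
  by rewrite subr_ge0 (ltW (tanh_lt1 _)).
have := ler_wpM2r (_ : 0 <= 1 - q_ a) te; rewrite subr_ge0 (ltW q1) => /(_ isT).
by move=> /le_trans/(_ yt); rewrite mulrAC ler_pdivrMr// ler_pM2l.
Unshelve. all: end_near. Qed.
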